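(* Let $(X,d)$ be a metric space. If $(X,d)$ is a length space, then $\mathrm{Lip}^1$ is a sheaf, i.e. $\mathrm{Lip}^1(X)=\mathrm{Lip}^1_{\mathrm{loc}}(X)$. Conversely, if $(X,d)$ is locally complete and $\mathrm{Lip}^1$ is a sheaf, then $(X,d)$ is a length space.
   Context: Here $d:X\times X\to[0,\infty)$ is a (finite-valued) metric. Closed balls are $B(x,r)=\{y\in X\mid d(x,y)\le r\}$. A path is a continuous map $\gamma:I\to X$ from an interval $I\subset\mathbb{R}$; its length is $$L(\gamma)=\sup\Big\{\sum_{k=0}^{n-1} d(\gamma(t_{k+1}),\gamma(t_k))\;\Big|\; n\in\mathbb{N},\ t_0<t_1<\dots<t_n,\ t_0,\dots,t_n\in I\Big\}\in[0,\infty].$$ The path metric induced by $d$ is $$d_\ell(x,y)=\inf\{L(\gamma)\mid \gamma:I\to X \text{ a path with } x,y\in\gamma(I)\}\in[0,\infty],\qquad \inf\emptyset=\infty .$$ $(X,d)$ is called a length space if $d=d_\ell$. $(X,d)$ is locally complete if every point $y\in X$ has some $r>0$ such that the closed ball $B(y,r)$ is complete. $\mathrm{Lip}^1(X)$ is the set of all $f:X\to\mathbb{R}$ with $|f(x)-f(y)|\le d(x,y)$ for all $x,y\in X$. $\mathrm{Lip}^1_{\mathrm{loc}}(X)$ is the set of all $f:X\to\mathbb{R}$ such that every $x\in X$ has an open neighborhood $V$ with $|f(y)-f(z)|\le d(y,z)$ for all $y,z\in V$. One says that $\mathrm{Lip}^1$ is a sheaf if $\mathrm{Lip}^1(X)=\mathrm{Lip}^1_{\mathrm{loc}}(X)$.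 *)

(* Defs.v *)
From mathcomp Require Import all_boot all_order all_algebra.
From mathcomp Require Import all_classical all_reals all_analysis.

Set Implicit Arguments.
Unset Strict Implicit.
Unset Printing Implicit Defensive.

Import Order.TTheory GRing.Theory Num.Theory.
Import numFieldNormedType.Exports.

Local Open Scope classical_set_scope.
Local Open Scope ring_scope.

(* A path on the interval I is represented by a total function R -> X of which
   only the restriction to I matters; every map I -> X has such an extension
   as soon as X is inhabited. *)
Definition is_path {R : realType} {X : metricType R} (I : set R) (g : R -> X) : Prop :=
  is_interval I /\ {within I, continuous g}.

Definition path_length {R : realType} {X : metricType R} (I : set R) (g : R -> X)
    : \bar R :=
  ereal_sup [set l | exists (n : nat) (t : nat -> R),
    [/\ forall k, (k < n)%N -> t k < t k.+1,
        forall k, (k <= n)%N -> I (t k) &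
        l = (\sum_(0 <= k < n) mdist (g (t k.+1)) (g (t k)))%:E]].

(* [ereal_inf set0 = +oo]: points joined by no path are at distance +oo. *)
Definition path_metric {R : realType} {X : metricType R} (x y : X) : \bar R :=
  ereal_inf [set l | exists (I : set R) (g : R -> X),
    [/\ is_path I g, (g @` I) x, (g @` I) y & l = path_length I g]].

Definition length_space {R : realType} (X : metricType R) : Prop :=
  forall x y : X, (mdist x y)%:E = path_metric x y.

(* Not the library's [closed_ball], which is the closure of the open ball. *)
Definition mclosed_ball {R : realType} {X : metricType R} (x : X) (r : R) : set X :=
  [set y | mdist x y <= r].

Definition complete_set {R : realType} {X : metricType R} (A : set X) : Prop :=
  forall u : nat -> X, (forall n, A (u n)) -> cauchy (u @ \oo) ->
    exists2 l, A l & u @ \oo --> l.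

Definition locally_complete {R : realType} (X : metricType R) : Prop :=
  forall y : X, exists2 r : R, 0 < r & complete_set (mclosed_ball y r).

Definition Lip1 {R : realType} (X : metricType R) : set (X -> R) :=
  [set f | forall x y, `|f x - f y| <= mdist x y].
Arguments Lip1 {R} X _.

Definition Lip1_loc {R : realType} (X : metricType R) : set (X -> R) :=
  [set f | forall x, exists2 V : set X, open_nbhs x V &
    forall y z, V y -> V z -> `|f y - f z| <= mdist y z].
Arguments Lip1_loc {R} X _.

Definition Lip1_is_sheaf {R : realType} (X : metricType R) : Prop := Lip1 X = Lip1_loc X.

(* Main.v *)
(* Along a path, a locally 1-Lipschitz function varies by at most the length
   of the path; for d = d_l this gives the first implication, and applied to
   the distance to a point it gives d <= d_l.

   Conversely, if closed balls B(x,a) and B(y,b) with a + b > d(x,y) were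
   disjoint, the difference of their cones max(a - d(x,.), 0) and
   max(b - d(y,.), 0) would be locally but not globally 1-Lipschitz.  Hence
   points at distance < l have a midpoint at distance < l/2 from both, and
   the strict inequality lets one bisect forever.  Where balls are complete
   the bisection converges to a 1-Lipschitz curve of length l, so locally
   d_l = d; then the truncation of d_l(x,.) is locally 1-Lipschitz, hence
   1-Lipschitz, hence d_l <= d. *)

Require Import Defs.
From mathcomp Require Import all_boot all_order all_algebra.
From mathcomp Require Import all_classical all_reals all_analysis.
From mathcomp Require Import lra zify.

Set Implicit Arguments.
Unset Strict Implicit.
Unset Printing Implicit Defensive.

Import Order.TTheory GRing.Theory Num.Theory.
Import numFieldNormedType.Exports.
Import metricType_numDomainType.

Local Open Scope classical_set_scope.
Local Open Scope ring_scope.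

(** * Chains along a path and the first implication *)

(** Records the endpoints that [path_length] forgets, so that a sum can be prolonged to the
    right. *)
Definition chain {R : realType} {X : metricType R} (I : set R) (g : R -> X)
    (a b l : R) : Prop :=
  exists (n : nat) (t : nat -> R),
    [/\ forall k, (k < n)%N -> t k < t k.+1,
        forall k, (k <= n)%N -> I (t k), t 0%N = a, t n = b &
        l = \sum_(0 <= k < n) mdist (g (t k.+1)) (g (t k))].

Lemma chain_le_path_length {R : realType} {X : metricType R} (I : set R)
    (g : R -> X) (a b l : R) :
  chain I g a b l -> (l%:E <= path_length I g)%E.
Proof.
by move=> [n [t [tlt tI _ _ ->]]]; apply: ereal_sup_ubound; exists n, t.
Qed.

Lemma chain_refl {R : realType} {X : metricType R} (I : set R) (g : R -> X)
    (a : R) :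
  I a -> chain I g a a 0.
Proof. by move=> Ia; exists 0%N, (fun=> a); split=> //; rewrite big_nil. Qed.

Lemma chain_rcons {R : realType} {X : metricType R} (I : set R) (g : R -> X)
    (a b c l : R) :
  chain I g a b l -> b < c -> I c -> chain I g a c (l + mdist (g c) (g b)).
Proof.
move=> [n [t [tlt tI t0 tn ->]]] bc Ic.
exists n.+1, (fun k => if (k <= n)%N then t k else c); split=> [k kn|k kn|||].
- rewrite -ltnS kn; case: ltnP => [/tlt//|nk].
  by have -> : k = n; [lia | rewrite tn].
- by case: ifP => // kn'; exact: tI.
- by [].
- by rewrite ltnn.
- rewrite big_nat_recr//= leqnn ltnn tn; congr (_ + _).
  by apply: eq_big_nat => k /andP[_ kn]; rewrite kn ltnW.
Qed.

(** Continuous induction on [S], the parameters reached by a good chain: around [sup S] the function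
    is 1-Lipschitz, so one more step goes past [sup S] unless [b] is reached. *)
Lemma Lip1_loc_chain {R : realType} {X : metricType R} (f : X -> R) (I : set R)
    (g : R -> X) (a b : R) :
  Lip1_loc X f -> is_path I g -> I a -> I b -> a <= b ->
  exists2 l, chain I g a b l & `|f (g b) - f (g a)| <= l.
Proof.
move=> fL [Iitv /subspace_continuousP gc] Ia Ib ab.
have abI t : a <= t -> t <= b -> I t.
  by move=> at_ tb; apply: (Iitv a b) => //; rewrite at_ tb.
pose S := [set t | a <= t <= b /\
  exists2 l, chain I g a t l & `|f (g t) - f (g a)| <= l].
have Sa : S a.
  split; first by rewrite lexx ab.
  by exists 0; [exact: chain_refl | rewrite subrr normr0].
have supS : has_sup S.
  by split; [exists a | exists b => t [/andP[]]].
have as_ : a <= sup S by apply: ub_le_sup => //; case: supS.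
have sb : sup S <= b by apply: ge_sup; [exists a | move=> t [/andP[]]].
have Is := abI _ as_ sb.
have [V [Vo Vs] fV] := fL (g (sup S)).
have /(_ V)/= := gc _ Is; rewrite nbhsE/= => /(_ _)[].
  by exists V.
move=> e /= e0 eV.
have {}eV t : a <= t -> t <= b -> `|sup S - t| < e -> V (g t).
  by move=> at_ tb te; apply: eV => //=; exact: abI.
have [t St st] := sup_adherent e0 supS.
have ts : t <= sup S by apply: ub_le_sup => //; case: supS.
case: (St) => /andP[at_ tb] [l tl fl].
have Vt : V (g t) by apply: eV => //; rewrite ger0_norm; lra.
(* [u] lies beyond [sup S], capped at [b], and close enough for [g u] to stay in [V]. *)
pose u := Num.min b (sup S + e / 2).
have [ub us] : u <= b /\ u <= sup S + e / 2 by rewrite !ge_min !lexx orbT.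
have uE : u = b \/ u = sup S + e / 2.
  by rewrite /u minElt; case: ifP; [left|right].
have [tu|ut] := ltP t u; last first.
  by exists l; have <- : t = b by case: uE => uE; lra.
have su : sup S <= u by case: uE => ->; lra.
have Vu : V (g u) by apply: eV => //; rewrite ?ler0_norm; lra.
have Su : S u.
  split; first by rewrite ub; lra.
  exists (l + mdist (g u) (g t)); first by apply: chain_rcons => //; apply: abI; lra.
  have := fV _ _ Vu Vt.
  have := ler_distD (f (g t)) (f (g u)) (f (g a)); lra.
(* [u] is in [S], which rules out [sup S + e / 2] and leaves [b]. *)
have us' : u <= sup S by apply: ub_le_sup => //; case: supS.
have <- : u = b by case: uE; lra.
by case: Su.
Qed.

Lemma Lip1_loc_le_path_length {R : realType} {X : metricType R} (f : X -> R)
    (I : set R) (g : R -> X) (x y : X) :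
  Lip1_loc X f -> is_path I g -> (g @` I) x -> (g @` I) y ->
  (`|f x - f y|%:E <= path_length I g)%E.
Proof.
move=> fL gp [a Ia <-] [b Ib <-].
wlog ab : a b Ia Ib / a <= b.
  by move=> h; have [|/ltW] := leP a b; [|rewrite distrC]; exact: h.
have [l cl] := Lip1_loc_chain fL gp Ia Ib ab.
rewrite distrC -lee_fin => /le_trans; apply; exact: chain_le_path_length cl.
Qed.

Lemma Lip1_sub_loc {R : realType} {X : metricType R} : Lip1 X `<=` Lip1_loc X.
Proof. by move=> f fL x; exists setT => //; split => //; exact: openT. Qed.

Lemma Lip1_mdist {R : realType} {X : metricType R} (x : X) : Lip1 X (mdist x).
Proof.
move=> y z; rewrite ler_distl.
have := metric_triangle x y z; have := metric_triangle x z y.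
rewrite (metric_sym z y); lra.
Qed.

Lemma mdist_le_path_metric {R : realType} {X : metricType R} (x y : X) :
  ((mdist x y)%:E <= path_metric x y)%E.
Proof.
apply: le_ereal_inf_tmp => _ [I [g [gp xg yg ->]]].
have := Lip1_loc_le_path_length (Lip1_sub_loc (Lip1_mdist x)) gp xg yg.
by rewrite mdistxx sub0r normrN ger0_norm ?mdist_ge0.
Qed.

Lemma length_space_sheaf {R : realType} {X : metricType R} :
  length_space X -> Lip1_is_sheaf X.
Proof.
move=> Xl; apply/seteqP; split; first exact: Lip1_sub_loc.
move=> f fL x y; rewrite -lee_fin Xl.
apply: le_ereal_inf_tmp => _ [I [g [gp xg yg ->]]].
exact: Lip1_loc_le_path_length.
Qed.

(** * Approximate midpoints from the sheaf property *)

(* If the balls were disjoint, the difference of their two cones would be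
   locally 1-Lipschitz, while it drops by a + b from x to y. *)
Lemma sheaf_balls_meet {R : realType} {X : metricType R} (x y : X) (a b : R) :
  Lip1_is_sheaf X -> 0 <= a -> 0 <= b -> mdist x y < a + b ->
  exists z, mdist x z <= a /\ mdist z y <= b.
Proof.
move=> Xs a0 b0 xyab; apply: contrapT => noz.
have disj z : a < mdist x z \/ b < mdist y z.
  have [|xza] := ltP a (mdist x z); first by left.
  have [|yzb] := ltP b (mdist y z); first by right.
  by case: noz; exists z; rewrite (metric_sym z).
pose cone (p : X) (c : R) z := Num.max (c - mdist p z) 0.
have coneL p c : Lip1 X (cone p c).
  move=> u v; rewrite /cone; have := Lip1_mdist p u v; rewrite !ler_distl.
  have := mdist_ge0 u v; rewrite !maxElt.
  by case: (ltP (c - mdist p u) 0); case: (ltP (c - mdist p v) 0); lra.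
have cone0 p c z : c < mdist p z -> cone p c z = 0.
  by move=> ?; rewrite /cone max_r; lra.
have outside (p : X) (c : R) z : c < mdist p z ->
    open_nbhs z [set w | c < mdist p w].
  move=> cz; split=> //; rewrite openE => w /= cw.
  apply/nbhs_mdistP; exists (mdist p w - c) => /=; first by rewrite subr_gt0.
  move=> v /=; have := metric_triangle p v w; rewrite (metric_sym v w); lra.
have fL : Lip1_loc X (fun z => cone x a z - cone y b z).
  (* Each point has a neighborhood outside one of the balls, where one cone vanishes and the other
     is 1-Lipschitz. *)
  move=> z; case: (disj z) => /outside Uz; eexists; try exact: Uz.
    by move=> u v /= /cone0-> /cone0->; rewrite !sub0r -opprD normrN coneL.
  by move=> u v /= /cone0-> /cone0->; rewrite !subr0 coneL.
have : Lip1 X (fun z => cone x a z - cone y b z) by rewrite Xs.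
move=> /(_ x y).
have [xb ya] : b < mdist y x /\ a < mdist x y.
  by case: (disj x) (disj y) => [|?] []; rewrite ?mdistxx; lra.
rewrite (cone0 y b x xb) (cone0 x a y ya) /cone !mdistxx !subr0 sub0r opprK.
by rewrite !max_l//; rewrite ger0_norm; lra.
Qed.

Lemma sheaf_midpoint {R : realType} {X : metricType R} (l : R) (x y : X) :
  Lip1_is_sheaf X -> mdist x y < l ->
  exists z, mdist x z < l / 2 /\ mdist z y < l / 2.
Proof.
move=> Xs xyl; have xy0 := mdist_ge0 x y.
(* [a + a] is the mean of [mdist x y] and [l], hence strictly between them. *)
pose a := (mdist x y + l) / 4.
have [|||z [xz zy]] := @sheaf_balls_meet _ _ x y a a Xs; try (rewrite /a; lra).
by exists z; rewrite /a in xz zy; split; lra.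
Qed.

(** * Dyadic subdivision and rounding *)

(* Only the indices k <= 2 ^ n matter; continuing level 0 by the constant z
   makes the bounds below hold for every k. *)
Fixpoint dyadic {R : realType} {X : metricType R} (mid : R -> X -> X -> X)
    (y z : X) (l : R) (n k : nat) : X :=
  match n with
  | 0%N => if k == 0%N then y else z
  | n'.+1 => let u := dyadic mid y z l n' k./2 in
      if odd k then mid (l / 2 ^+ n') u (dyadic mid y z l n' k./2.+1) else u
  end.

Lemma near_geometric_lt {R : realType} (l e : R) :
  0 < e -> \forall n \near \oo, l / 2 ^+ n < e.
Proof.
move=> e0; have /cvgr_lt/(_ _ e0) : geometric l (2^-1 : R) n @[n --> \oo] --> 0.
  by apply: cvg_geometric; rewrite ger0_norm; lra.
by apply: filterS => n; rewrite /= exprVn.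
Qed.

(** Doubling the scaled parameter passes to the next dyadic level; halving the new index recovers
    the old one. *)
Lemma truncn_halfD {R : realType} (x : R) :
  (Num.truncn (x + x))./2 = Num.truncn x.
Proof.
have [x0|x0] := ltP x 0.
  have t0 (w : R) : w < 0 -> Num.truncn w = 0%N.
    by move=> w0; apply/truncn0Pn; rewrite -ltNge; lra.
  by rewrite !t0//; lra.
apply/esym/truncn_def.
have /truncn_itv : 0 <= x + x by lra.
set k := Num.truncn _; have := odd_double_half k.
move: (k./2) (odd k) => h b <-; rewrite -addnn -addnS !natrD -[h.+1%:R]natr1.
by case: b => /=; lra.
Qed.

Lemma dist_truncn {R : realType} (x y : R) : x <= y ->
  (Num.truncn y)%:R - (Num.truncn x)%:R <= y - x + 1 :> R.
Proof.
move=> xy; have := truncnS_gt x; rewrite -natr1.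
have [y0|y0] := ltP y 0; last by have /andP[] := truncn_itv y0; lra.
have -> : Num.truncn y = 0%N by apply/truncn0Pn; rewrite -ltNge; lra.
by have := ler0n R (Num.truncn x); lra.
Qed.

(** * Points joined by 1-Lipschitz curves *)

(* The 1-Lipschitz curve from x to y is parametrised by [0, l] but defined on
   the whole line, so concatenation needs no domain bookkeeping. *)
Definition reach {R : realType} {X : metricType R} (x y : X) (l : R) : Prop :=
  0 <= l /\ exists g : R -> X,
    [/\ forall s t, mdist (g s) (g t) <= `|s - t|, g 0 = x & g l = y].

Lemma reach_refl {R : realType} {X : metricType R} (x : X) : reach x x 0.
Proof. by split=> //; exists (fun=> x); split=> // s t; rewrite mdistxx. Qed.

Lemma reach_trans {R : realType} {X : metricType R} (x y z : X) (l m : R) :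
  reach x y l -> reach y z m -> reach x z (l + m).
Proof.
move=> [l0 [g [gL g0 gl]]] [m0 [h [hL h0 hm]]]; split; first exact: addr_ge0.
exists (fun t => if t <= l then g t else h (t - l)); split; last 2 first.
- by rewrite l0.
- case: ifP => lm; last by rewrite addrC addKr.
  (* The endpoint [l + m] falls in the first branch only when the second curve has length zero. *)
  have m00 : m = 0 by lra.
  by rewrite m00 addr0 gl -h0 -m00.
- move=> s t; wlog st : s t / s <= t.
    move=> H; have [|/ltW] := leP s t; first exact: H.
    by rewrite metric_sym distrC; exact: H.
  case: ifP => sl; case: ifP => tl.
  + exact: gL.
  (* Across the junction, the estimate goes through [y], which is both [g l] and [h 0]. *)
  + have := metric_triangle (g s) y (h (t - l)).
    have := gL s l; have := hL 0 (t - l); rewrite gl h0 sub0r normrN.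
    by rewrite !(distrC s) !ger0_norm; lra.
  + lra.
  + by have := hL (s - l) (t - l); rewrite opprB addrA subrK.
Qed.

Lemma reach_path_metric {R : realType} {X : metricType R} (x y : X) (l : R) :
  reach x y l -> (path_metric x y <= l%:E)%E.
Proof.
move=> [l0 [g [gL g0 gl]]]; apply: ge_ereal_inf.
exists (path_length `[0, l]%classic g).
  exists `[0, l]%classic, g; split=> //; last 2 first.
  - by exists 0 => //=; rewrite in_itv /= lexx.
  - by exists l => //=; rewrite in_itv /= lexx andbT.
  split; first exact: interval_is_interval.
  apply: continuous_subspaceT => s; apply/cvgrPdist_lt => e e0.
  apply/nbhs_ballP; exists e => // t /= st; exact: le_lt_trans (gL s t) st.
apply: ge_ereal_sup => _ [n [t [tlt tI ->]]]; rewrite lee_fin.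
have [t0 tn] : 0 <= t 0%N /\ t n <= l.
  have /= := tI 0%N (leq0n n); have /= := tI n (leqnn n).
  by rewrite !in_itv /= => /andP[_ ?] /andP[].
apply: (@le_trans _ _ (\sum_(0 <= k < n) (t k.+1 - t k))).
  apply: ler_sum_nat => k /andP[_ kn]; apply: le_trans (gL _ _) _.
  by rewrite ger0_norm// subr_ge0 ltW// tlt.
by rewrite telescope_sumr//; lra.
Qed.

(** * Convergence of the bisection *)

Section DyadicCurve.
Context {R : realType} {X : metricType R}.
Variables (mid : R -> X -> X -> X) (y z : X) (l : R).
Hypothesis midP : forall l u v, mdist u v < l ->
  mdist u (mid l u v) < l / 2 /\ mdist (mid l u v) v < l / 2.
Hypothesis yzl : mdist y z < l.

Local Notation D := (dyadic mid y z l).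

Let l_gt0 : 0 < l.
Proof. exact: le_lt_trans (mdist_ge0 y z) yzl. Qed.

Let geo_gt0 n : 0 < l / 2 ^+ n.
Proof. by rewrite divr_gt0// exprn_gt0. Qed.

Let geoS n : l / 2 ^+ n.+1 = l / 2 ^+ n / 2.
Proof. by rewrite exprSr invfM mulrA. Qed.

Lemma dyadic_step n k : mdist (D n k) (D n k.+1) < l / 2 ^+ n.
Proof.
elim: n k => [|n IHn] k /=.
  by rewrite expr0 divr1; case: k => //= k; rewrite mdistxx.
rewrite geoS; have [mid1 mid2] := midP (IHn k./2).
by have := uphalf_half k; rewrite /uphalf -/half; case: (odd k) => /= ->.
Qed.

Lemma dyadic_refine n k : mdist (D n k./2) (D n.+1 k) <= l / 2 ^+ n.+1.
Proof.
rewrite geoS /=; have [mid1 _] := midP (dyadic_step n k./2).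
by case: (odd k); [exact: ltW | rewrite mdistxx; have := geo_gt0 n; lra].
Qed.

(** The bound is the geometric sum [l + l / 2 + ... + l / 2 ^+ n]: level 0 contributes [l], each
    refinement its own step. *)
Lemma dyadic_bounded n k : mdist y (D n k) <= 2 * l - l / 2 ^+ n.
Proof.
elim: n k => [|n IHn] k.
  have := l_gt0; have := yzl; rewrite expr0 divr1 /=.
  by case: eqP => _; rewrite ?mdistxx; lra.
have := metric_triangle y (D n k./2) (D n.+1 k).
have := IHn k./2; have := dyadic_refine n k; rewrite geoS; lra.
Qed.

Lemma dyadic_dist n k j : mdist (D n k) (D n (k + j)) <= j%:R * (l / 2 ^+ n).
Proof.
elim: j => [|j IHj]; first by rewrite addn0 mdistxx mul0r.
have := metric_triangle (D n k) (D n (k + j)) (D n (k + j).+1).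
have := dyadic_step n (k + j); rewrite addnS -natr1; lra.
Qed.

Lemma dyadic_left n : D n 0 = y.
Proof. by elim: n. Qed.

Lemma dyadic_right n : D n (2 ^ n) = z.
Proof. by elim: n => //= n IHn; rewrite expnS mul2n odd_double doubleK. Qed.

(** Level [n] as a step function of [t], each step having length [l / 2 ^+ n]. *)
Let c n t := D n (Num.truncn (t / l * 2 ^+ n)).

Let c_refine n m t : mdist (c n t) (c (n + m) t) <= l / 2 ^+ n - l / 2 ^+ (n + m).
Proof.
elim: m => [|m IHm]; first by rewrite addn0 mdistxx subrr.
have := metric_triangle (c n t) (c (n + m) t) (c (n + m).+1 t).
have := dyadic_refine (n + m) (Num.truncn (t / l * 2 ^+ (n + m).+1)).
rewrite {1}exprSr mulrA mulr_natr mulr2n truncn_halfD -/(c _ t) -/(c _.+1 t).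
by rewrite addnS geoS; lra.
Qed.

Let c_cauchy t : cauchy (c ^~ t @ \oo).
Proof.
apply: cauchy_exP => e e0.
have [N _ lN] := near_geometric_lt l e0.
exists (c N t); exists N => // n /= Nn; rewrite ballEmdist /=.
have := c_refine N (n - N) t; rewrite subnKC//.
by have := lN N (leqnn _); have := geo_gt0 n; rewrite /=; lra.
Qed.

(** The indices differ by at most [|s - t| / l * 2 ^+ n + 1], and consecutive points by less than
    [l / 2 ^+ n]; the extra 1 from rounding gives the error term. *)
Let c_lip n s t : mdist (c n s) (c n t) <= `|s - t| + l / 2 ^+ n.
Proof.
wlog st : s t / s <= t.
  move=> h; have [|/ltW] := leP s t; first exact: h.
  by rewrite metric_sym distrC; exact: h.
have st' : s / l * 2 ^+ n <= t / l * 2 ^+ n.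
  by rewrite ler_wpM2r ?exprn_ge0// ler_wpM2r// invr_ge0 ltW.
have := dyadic_dist n (Num.truncn (s / l * 2 ^+ n))
  (Num.truncn (t / l * 2 ^+ n) - Num.truncn (s / l * 2 ^+ n)).
rewrite subnKC ?le_truncn// => /le_trans; apply.
rewrite natrB ?le_truncn//.
apply: le_trans (ler_wpM2r (ltW (geo_gt0 n)) (dist_truncn st')) _.
rewrite mulrDl mul1r lerD2r -mulrBl -mulrBl.
by rewrite mulrACA mulrA mulfK ?expf_neq0// divfK ?gt_eqF// distrC ler_norm.
Qed.

(** All [c n t] stay within [2 * l] of [y], hence in the complete ball, so the step functions
    converge pointwise; the error in [c_lip] vanishes in the limit. *)
Lemma dyadic_curve_reach (p : X) (r : R) :
  complete_set (mclosed_ball p r) -> mdist p y + 2 * l <= r -> reach y z l.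
Proof.
move=> pc yr.
have cg t : exists x : X, c ^~ t @ \oo --> x.
  have [|x _ tx] := pc (c ^~ t) _ (c_cauchy t); last by exists x.
  move=> n; rewrite /mclosed_ball /=.
  have := metric_triangle p y (c n t).
  have := dyadic_bounded n (Num.truncn (t / l * 2 ^+ n)).
  by have := geo_gt0 n; rewrite -/(c n t); lra.
have [g gP] := choice cg.
(* At the parameters [0] and [l] every level already has the exact value. *)
have g_const t x : (forall n, c n t = x) -> g t = x.
  move=> cx; have := gP t; rewrite (_ : c ^~ t = fun=> x); last exact/funext.
  by move=> /cvg_unique; apply; [exact: metric_hausdorff | exact: cvg_cst].
split; first exact: ltW.
exists g; split.
- move=> s t; apply/ler_addgt0Pl => e e0.
  have e3 : 0 < e / 3 by rewrite divr_gt0.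
  near \oo => n.
  have sn : mdist (g s) (c n s) < e / 3.
    by near: n; exact: (cvgr_dist_lt (gP s)).
  have tn : mdist (g t) (c n t) < e / 3.
    by near: n; exact: (cvgr_dist_lt (gP t)).
  have ln : l / 2 ^+ n < e / 3 by near: n; exact: near_geometric_lt.
  have := c_lip n s t; have := metric_triangle (g s) (c n s) (g t).
  have := metric_triangle (c n s) (c n t) (g t).
  by rewrite (metric_sym (c n t) (g t)); lra.
- by apply: g_const => n; rewrite /c !mul0r truncn0 dyadic_left.
- apply: g_const => n; rewrite /c divff ?gt_eqF// mul1r -natrX natrK.
  exact: dyadic_right.
Unshelve. all: by end_near. Qed.

End DyadicCurve.

(** * From local to global *)

Lemma sheaf_reach_local {R : realType} {X : metricType R} :
  locally_complete X -> Lip1_is_sheaf X -> forall p : X,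
  exists2 r, 0 < r & forall y z l, mdist p y < r -> mdist y z < l -> l < 2 * r ->
    reach y z l.
Proof.
move=> Xc Xs p; have [r r0 pr] := Xc p.
(* One fifth for [mdist p y] and four fifths for [2 * l] with [l < 2 * (r / 5)] add up to [r]. *)
exists (r / 5); first by rewrite divr_gt0.
have /choice[mid midP] : forall q : R * X * X, exists w, mdist q.1.2 q.2 < q.1.1 ->
    mdist q.1.2 w < q.1.1 / 2 /\ mdist w q.2 < q.1.1 / 2.
  move=> [[l u] v] /=; have [uv|uv] := pselect (mdist u v < l).
    by have [w] := sheaf_midpoint Xs uv; exists w.
  (* Default value, making [mid] total. *)
  by exists u => /uv.
move=> y z l py yzl lr.
apply: (@dyadic_curve_reach _ _ (fun l u v => mid (l, u, v)) y z l _ yzl p r) => //.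
  by move=> l' u v /(midP (l', u, v)).
by lra.
Qed.

(** The truncated infimum [f] of curve lengths from [x] is locally 1-Lipschitz, so the sheaf
    property gives [f y <= mdist x y], below the cut-off. *)
Lemma sheaf_reach {R : realType} {X : metricType R} (x y : X) (e : R) :
  locally_complete X -> Lip1_is_sheaf X -> 0 < e ->
  exists2 l, reach x y l & l < mdist x y + e.
Proof.
move=> Xc Xs e0; pose m := mdist x y + e.
have m0 : 0 <= m by have := mdist_ge0 x y; rewrite /m; lra.
(* the cut-off at m makes f finite-valued *)
pose E z := [set l | l = m \/ reach x z l].
pose f z := inf (E z).
have Elb z : lbound (E z) 0 by move=> l [->//|[]].
have Einf z : has_inf (E z) by split; [exists m; left | exists 0].
have f_le z w l : reach w z l -> f z <= f w + l.
  move=> wz; apply/ler_addgt0Pr => d d0.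
  have [k kE kf] := inf_adherent d0 (Einf w).
  have l0 : 0 <= l by case: wz.
  have : f z <= k + l.
    case: kE => [km|xw].
      have : f z <= m by apply: ge_inf; [exact: (Einf z).2 | left].
      by rewrite km; lra.
    by apply: ge_inf; [exact: (Einf z).2 | right; exact: reach_trans xw wz].
  by rewrite -/(f w) in kf; lra.
have fL : Lip1_loc X f.
  move=> p; have [r r0 pr] := sheaf_reach_local Xc Xs p.
  exists (ball p r)°; first exact: open_nbhs_ball (PosNum r0).
  move=> z w /interior_subset + /interior_subset; rewrite !ballEmdist /= => pz pw.
  have zw : mdist z w < 2 * r.
    by have := metric_triangle z p w; rewrite (metric_sym z p); lra.
  have key u v : mdist p u < r -> mdist u v < 2 * r -> f v <= f u + mdist u v.
    move=> pu uv; apply/ler_addgt0Pr => d d0.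
    (* [l] must exceed [mdist u v] by at most [d] and remain below [2 * r]; the second term is the
       midpoint of [mdist u v] and [2 * r]. *)
    pose l := Num.min (mdist u v + d) ((mdist u v + 2 * r) / 2).
    have l1 : l <= mdist u v + d by rewrite ge_min lexx.
    have [l2 l3] : l < 2 * r /\ mdist u v < l.
      by rewrite gt_min lt_min; split; [apply/orP; right|apply/andP; split]; lra.
    have := f_le _ _ _ (pr u v l pu l3 l2); lra.
  rewrite ler_distl; have := key z w pz zw.
  by have := key w z pw; rewrite (metric_sym w) => /(_ zw); lra.
have : Lip1 X f by rewrite Xs.
move=> /(_ x y); rewrite ler_distl => /andP[fxy _].
have fx : f x <= 0.
  by apply: ge_inf; [exact: (Einf x).2 | right; exact: reach_refl].
have [l ly lf] := inf_adherent e0 (Einf y).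
have lm : l < m by rewrite -/(f y) in lf; rewrite /m; lra.
(* Being below [m], the length [l] is not the cut-off value, so a curve realises it. *)
by exists l => //; case: ly => // ly; rewrite ly ltxx in lm.
Qed.


Theorem theorem3p2 (R : realType) (X : metricType R) :
  (length_space X -> Lip1_is_sheaf X) /\
  (locally_complete X -> Lip1_is_sheaf X -> length_space X).
Proof.
split; first exact: length_space_sheaf.
move=> Xc Xs x y; apply/eqP; rewrite eq_le mdist_le_path_metric /=.
apply/lee_addgt0Pr => e e0.
have [l xyl le] := sheaf_reach x y Xc Xs e0.
by apply: le_trans (reach_path_metric xyl) _; rewrite -EFinD lee_fin ltW.
Qed.
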